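(* Let $p\geq 0$ and let $G$ be a nearly balanced bipartite graph of order $2n-1$ with minimum degree $\delta(G)\geq k$. (i) If $k=p+1$, $n\geq 2k+3$, and $\rho(G)\geq \rho(M_{n,n-1}^{1,n-k-1})$, then $G$ is $2p$-Hamilton-biconnected unless $G= M_{n,n-1}^{1,n-k-1}$. (ii) If $k\geq p+2$, $n\geq \frac{(k+2)(k-p+1)}{2}$, and $\rho(G)\geq \rho(M_{n,n-1}^{n-k,k-p-1})$, then $G$ is $2p$-Hamilton-biconnected unless $G= M_{n,n-1}^{n-k,k-p-1}$.
   Context: $\rho(G)$ is the largest eigenvalue of the adjacency matrix. A bipartite graph $G=(X,Y;E)$ is nearly balanced if $|X|=|Y|+1$; it is Hamilton-biconnected if for any two distinct $u,v\in X$ there is a Hamiltonian path with ends $u,v$. A vertex set $W$ is balanced if $|W\cap X|=|W\cap Y|$; $G$ is $2p$-Hamilton-biconnected if for every balanced $W$ with $|W|=2p$, the subgraph induced by $V(G)\setminus W$ is Hamilton-biconnected. $M_{n,m}^{s,t}$: parts $X=X_1\cup X_2$ (with $n$ vertices), $Y=Y_1\cup Y_2$ (with $m$ vertices), $|X_1|=s$, $|X_2|=n-s$, $|Y_1|=m-t$, $|Y_2|=t$; edges are all pairs between $X_1$ and $Y_1$, between $X_2$ and $Y_1$, and between $X_2$ and $Y_2$. ''$G=H$'' means isomorphic. *)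

(* Defs.v *)
From HB Require Import structures.
From mathcomp Require Import all_boot all_order all_algebra.
From mathcomp Require Import reals.
Set Implicit Arguments. Unset Strict Implicit. Unset Printing Implicit Defensive.
Import Order.TTheory GRing.Theory Num.Theory.
Local Open Scope ring_scope.

Section Graphs.
Variable T : finType.

(* A bipartite graph G = (X, Y; E): simple graph given by a symmetric
   relation e, with parts X and Y := ~: X; every edge joins X and Y. *)
Definition bipartite (e : rel T) (X : {set T}) : Prop :=
  (forall x y, e x y = e y x) /\
  (forall x y, e x y -> (x \in X) != (y \in X)).

Definition nearly_balanced (X : {set T}) : Prop := #|X| = (#|~: X| + 1)%N.

Definition min_degree_ge (e : rel T) (k : nat) : Prop :=
  forall x : T, (k <= #|[set y | e x y]|)%N.

Definition ham_path (e : rel T) (S : {set T}) (u v : T) : Prop :=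
  exists s : seq T,
    [/\ uniq (u :: s), path e u s, last u s = v & [set x in u :: s] = S].

Definition ham_biconnected (e : rel T) (X S : {set T}) : Prop :=
  forall u v, u \in X :&: S -> v \in X :&: S -> u != v -> ham_path e S u v.

Definition ham_biconnected_2p (e : rel T) (X : {set T}) (p : nat) : Prop :=
  forall W : {set T}, #|W :&: X| = #|W :\: X| -> #|W| = (2 * p)%N ->
    ham_biconnected e X (~: W).

Definition adjmx (R : realType) (e : rel T) : 'M[R]_#|T| :=
  \matrix_(i, j) ((e (enum_val i) (enum_val j))%:R : R).

Definition is_spectral_radius (R : realType) (e : rel T) (r : R) : Prop :=
  eigenvalue (adjmx R e) r /\
  (forall a : R, eigenvalue (adjmx R e) a -> a <= r).

End Graphs.

Definition graph_iso (T T' : finType) (e : rel T) (e' : rel T') : Prop :=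
  exists f : T -> T', bijective f /\ forall x y, e' (f x) (f y) = e x y.

Definition rho_le (R : realType) (T T' : finType) (e : rel T) (e' : rel T')
  : Prop :=
  exists (r : R) (r' : R),
    [/\ is_spectral_radius e r, is_spectral_radius e' r' & r <= r'].

(* M_{n,m}^{s,t}: X = inl 'I_n, Y = inr 'I_m; X1 = {inl i | i < s},
   X2 = {inl i | s <= i}, Y1 = {inr j | j < m - t}, Y2 = {inr j | m - t <= j}.
   Edges: X1-Y1, X2-Y1, X2-Y2 (all pairs). *)
Definition Mrel (n m s t : nat) : rel ('I_n + 'I_m)%type :=
  fun x y =>
    match x, y with
    | inl i, inr j => ((j < m - t) || (s <= i))%N
    | inr j, inl i => ((j < m - t) || (s <= i))%N
    | _, _ => false
    end.
Arguments rho_le R {T T'} e e'.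
Arguments Mrel n m s t : clear implicits.

(* Main.v *)
Require Import Defs.
From HB Require Import structures.
From mathcomp Require Import all_boot all_order all_algebra.
From mathcomp Require Import boolp reals zify ring lra.
Import Order.TTheory GRing.Theory Num.Theory.
Set Implicit Arguments. Unset Strict Implicit. Unset Printing Implicit Defensive.

(** Put N = n - p and d = k - p, and suppose that G - W has no Hamiltonian path
    from u to v.  Adding an edge xy with deg x + deg y > N never creates such a
    path (Bondy-Chvatal), so a saturated supergraph of G - W shows that, for
    some b with max(2, d) <= b <= N - d, the graph G has b - 1 vertices of Y
    of degree at most b + p.

    Let w be the entrywise absolute value of an eigenvector for rho(G), so that
    rho w <= A w.  Comparing the sum of w over X with its largest sum over a
    (b + p)-subset of X gives q_b(rho^2) <= 0, where q_b is the quadratic whose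
    larger root is rho(M_{n,n-1}^{N-b,b-1})^2; equality forces G to be that
    graph.  No Perron-Frobenius theory is needed.

    Finally q_b > q_{b0} on the positive axis for every other admissible b,
    where b0 = N - 1 in case (i) and b0 = d in case (ii), while the hypothesis
    on rho gives q_{b0}(rho(G)^2) >= 0.  Hence b = b0 and G is the excluded
    graph. *)

(** * Hamiltonian paths in bipartite graphs *)

Section HamiltonPaths.
Variable T : finType.
Implicit Types (e : rel T) (X S : {set T}) (x y z u v : T) (l : seq T).

Definition deg_in e S x := #|[set y in S | e x y]|.

Definition add_edge e x y : rel T :=
  fun a b => [|| e a b, (a == x) && (b == y) | (a == y) && (b == x)].

Lemma sorted_catE x0 e l1 l2 :
  sorted e (l1 ++ l2) = [&& sorted e l1, sorted e l2 &
    [|| nilp l1, nilp l2 | e (last x0 l1) (head x0 l2)]].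
Proof.
case: l1 => [|a l1] /=; first by rewrite andbT.
case: l2 => [|b l2] /=; first by rewrite cats0 andbT.
by rewrite cat_path /= (andbC (e _ _)).
Qed.

Lemma last_rev x l : last x (rev l) = head x l.
Proof. by case: l => [|a l]; rewrite // rev_cons last_rcons. Qed.

Lemma sorted_rev_sym e l : symmetric e -> sorted e (rev l) = sorted e l.
Proof. by move=> es; rewrite rev_sorted; apply: eq_sorted => a b; rewrite es. Qed.

Lemma bipartite_add_edge e X x y :
  bipartite e X -> x \in X -> y \notin X -> bipartite (add_edge e x y) X.
Proof.
move=> [es eX] xX yX; split=> a b.
  by rewrite /add_edge es; congr (_ || _); rewrite orbC andbC [X in _ || X]andbC.
rewrite /add_edge; case/or3P=> [/eX //|/andP[/eqP-> /eqP->]|/andP[/eqP-> /eqP->]].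
  by rewrite xX (negbTE yX).
by rewrite xX (negbTE yX).
Qed.

Lemma sub_add_edge e x y : subrel e (add_edge e x y).
Proof. by move=> a b; rewrite /add_edge => ->. Qed.

(** The new edge needs both [x] and [y], so a sequence missing one of them uses old edges
    throughout. *)
Lemma sorted_add_edge_notin e x y z l :
  z \in [:: x; y] -> z \notin l -> sorted (add_edge e x y) l -> sorted e l.
Proof.
move=> zxy zl; apply: (sub_in_sorted (P := [pred a | a != z])); last first.
  by apply/allP => a al /=; apply: contraNneq zl => <-.
move=> a b /= az bz; rewrite /add_edge => /or3P[//|/andP[/eqP ax /eqP by_]|/andP[/eqP ay /eqP bx]].
  by move: zxy; rewrite !inE -ax -by_ ![z == _]eq_sym (negbTE az) (negbTE bz).
by move: zxy; rewrite !inE -ay -bx ![z == _]eq_sym (negbTE az) (negbTE bz).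
Qed.

Lemma cat_cons_inj z (P1 P2 Q1 Q2 : seq T) :
  z \notin P1 -> z \notin P2 -> P1 ++ z :: Q1 = P2 ++ z :: Q2 ->
  P1 = P2 /\ Q1 = Q2.
Proof.
move=> n1 n2 E; have sE : size P1 = size P2.
  have : index z (P1 ++ z :: Q1) = index z (P2 ++ z :: Q2) by rewrite E.
  by rewrite !index_cat (negbTE n1) (negbTE n2) /= eqxx !addn0.
by have /eqP := E; rewrite eqseq_cat // => /andP[/eqP -> /eqP[->]].
Qed.

(* With [pr z] the predecessor of [z] on the path, the degree condition leaves
   no room for the neighbours of [x] and the predecessors of the neighbours
   of [y] to be disjoint. *)
Lemma crossing_pair e X x y l :
  bipartite e X -> x \in X -> y \notin X -> ~~ e x y ->
  uniq l -> sorted (add_edge e x y) l -> y \in l ->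
  #|[set z in l] :\: X| + 2
    <= deg_in e [set z in l] x + deg_in e [set z in l] y ->
  exists P z Q, [/\ l = P ++ z :: Q, ~~ nilp P, e y z & e x (last x P)].
Proof.
move=> eB xX yX nxy Ul Sl yl; set S := [set z in l] => degxy.
have [es eX] := eB; have [_ fX] := bipartite_add_edge eB xX yX.
(* Two possible neighbours of [y] are set aside: the head [u], which has no predecessor, and the
   successor [ny] of [y], whose predecessor is [y]. If [y] is last, the default gives [ny = x],
   which is not a neighbour of [y]. *)
pose u := head x l; pose ny := nth x l (index y l).+1.
pose pr z := nth x l (index z l).-1.
pose D2 := [set z in S | e y z].
pose D2' := D2 :\ u :\ ny.
have idxP z : z \in l -> z != u -> 0 < index z l < size l.
  move=> zl zu; rewrite index_mem zl andbT lt0n; apply: contraNneq zu => i0.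
  by rewrite /u -nth0 -i0 nth_index.
have D2P z : z \in D2' -> [/\ z \in l, e y z, z != u & z != ny].
  by rewrite !inE => /and4P[-> -> -> ->].
have prX z : z \in D2' -> pr z \in (S :\: X) :\ y.
  move=> /D2P[zl eyz zu zny]; have /andP[i0 il] := idxP z zl zu.
  have zX : z \in X by move: (eX _ _ eyz); rewrite (negbTE yX); case: (z \in X).
  have jl : (index z l).-1 < size l := leq_ltn_trans (leq_pred _) il.
  rewrite !inE mem_nth // andbT; apply/andP; split.
    apply: contraNneq zny => prz.
    by rewrite /ny -prz index_uniq // prednK // nth_index.
  have := elimT (sortedP x) Sl (index z l).-1; rewrite prednK // => /(_ il)/fX.
  by rewrite nth_index // zX /pr; case: (_ \in X).
have prI : {in D2' &, injective pr}.
  move=> a b /D2P[al _ au _] /D2P[bl _ bu _].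
  have /andP[i0 il] := idxP a al au; have /andP[j0 jl] := idxP b bl bu.
  have il' : (index a l).-1 < size l := leq_ltn_trans (leq_pred _) il.
  have jl' : (index b l).-1 < size l := leq_ltn_trans (leq_pred _) jl.
  move/eqP; rewrite /pr nth_uniq // => /eqP ij.
  by rewrite -(nth_index x al) -(nth_index x bl) -(prednK i0) -(prednK j0) ij.
have [[j /setIP[jD1 /imsetP[z zD2 jz]]]|disj] :
    (exists j, j \in [set z in S | e x z] :&: (pr @: D2')) \/
    [set z in S | e x z] :&: (pr @: D2') = set0.
- by case: (set_0Vmem ([set z in S | e x z] :&: (pr @: D2'))) => [|[j]]; [right|left; exists j].
- have [zl eyz zu zny] := D2P z zD2.
  have /andP[i0 il] := idxP z zl zu.
  have jE : pr z = last x (take (index z l) l).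
    by rewrite -nth_last size_take il nth_take ?prednK.
  exists (take (index z l) l), z, (drop (index z l).+1 l); split => //.
  + by rewrite -[LHS](cat_take_drop (index z l)) (drop_nth x) // nth_index.
  + by rewrite /nilp size_take il -lt0n.
  + by move: jD1; rewrite inE -jE jz => /andP[_].
- exfalso.
  (* Two disjoint sets inside [(S :\: X) :\ y] would bound the degree sum by [#|S :\: X| + 1]. *)
  have sub : [set z in S | e x z] :|: (pr @: D2') \subset (S :\: X) :\ y.
    rewrite subUset; apply/andP; split; last first.
      by apply/subsetP => _ /imsetP[z zD ->]; exact: prX.
    apply/subsetP => z; rewrite !inE => /andP[-> exz]; rewrite andbT.
    apply/andP; split; first by apply: contraTneq exz => ->.
    by move: (eX _ _ exz); rewrite xX; case: (z \in X).
  have := subset_leq_card sub; rewrite cardsU disj cards0 subn0 card_in_imset //.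
  have yS : y \in S :\: X by rewrite !inE yX.
  have := cardsD1 y (S :\: X); rewrite yS.
  have := cardsD1 u D2; have := cardsD1 ny (D2 :\ u); rewrite -/D2'.
  move: degxy; rewrite /deg_in -/D2; clear; lia.
Qed.

(** The new edge can occur only between [x] and the head of [B]. If it does, a crossing pair allows
    one segment to be reversed: with [j] the predecessor of [z], the edges xy and jz are replaced by
    xj and yz, and both ends stay fixed. *)
Lemma rotate_path e X x y A B :
  bipartite e X -> x \in X -> y \notin X -> ~~ e x y ->
  let l := rcons A x ++ B in
  uniq l -> sorted (add_edge e x y) l -> y \in B ->
  #|[set z in l] :\: X| + 2
    <= deg_in e [set z in l] x + deg_in e [set z in l] y ->
  exists l', [/\ perm_eq l' l, sorted e l', head x l' = head x l
               & last x l' = last x l].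
Proof.
move=> eB xX yX nxy l Ul Sl yB degxy; have [es eX] := eB.
have := Sl; rewrite (sorted_catE x) => /and3P[SA SB con].
have := Ul; rewrite cat_uniq => /and3P[UA dAB UB].
have yA : y \notin rcons A x by apply/negP => yA; case/hasP: dAB; exists y.
have xB : x \notin B.
  by apply/negP => xB; case/hasP: dAB; exists x; rewrite // mem_rcons mem_head.
move: SA => /(sorted_add_edge_notin (z := y)); rewrite !inE eqxx orbT => /(_ isT yA) SA.
move: SB => /(sorted_add_edge_notin (z := x)); rewrite !inE eqxx => /(_ isT xB) SB.
have [exh|nexh] := boolP (e x (head x B)).
  exists l; split=> //; rewrite /l (sorted_catE x) SA SB last_rcons exh !orbT //.
have yl : y \in l by rewrite mem_cat yB orbT.
have xy : x != y by apply: contraNneq yX => <-.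
case: B yB con SB UB xB dAB nexh @l Ul Sl degxy yl => // b B yB con SB UB xB dAB nexh l Ul Sl degxy yl.
have {con} yb : b = y.
  move: con (negbTE nexh); rewrite last_rcons /nilp size_rcons /= /add_edge.
  move=> /or3P[->//|/andP[_ /eqP//]|/andP[/eqP xy' _]].
  by rewrite xy' eqxx in xy.
subst b => {yB}.
have [P [z [Q [lE nP eyz exj]]]] := crossing_pair eB xX yX nxy Ul Sl yl degxy.
have zy : z != y by apply: contraTneq eyz => ->; apply/negP => /eX; rewrite eqxx.
have zl : z \in l by rewrite lE mem_cat mem_head orbT.
have nzP : z \notin P.
  by move: Ul; rewrite lE cat_uniq => /and3P[_ /hasPn /(_ z (mem_head _ _))].
move: zl; rewrite mem_cat => /orP[zA|zB].
(* [z] lies before the new edge: the segment from [z] to [x] is reversed. *)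
- have [Q1 [AE QE]] : exists Q1, rcons A x = P ++ z :: Q1 /\ Q = Q1 ++ y :: B.
    case/splitPr AE: _ / zA => [A1 A2].
    have nzA : z \notin A1.
      by move: UA; rewrite AE cat_uniq => /and3P[_ /hasPn /(_ z (mem_head _ _))].
    have /(cat_cons_inj nzA nzP)[<- <-] : A1 ++ z :: (A2 ++ y :: B) = P ++ z :: Q.
      by rewrite -lE /l AE -catA.
    by exists A2.
  exists (P ++ rev (z :: Q1) ++ y :: B); split.
  + by rewrite /l AE -catA perm_cat2l perm_cat2r perm_rev.
  + move: SA; rewrite AE !(sorted_catE x) (sorted_rev_sym _ es) => /and3P[-> -> _].
    have lQ : last z Q1 = x by move: (last_rcons x A x); rewrite AE last_cat.
    have hd : head x (rev (z :: Q1) ++ y :: B) = x by rewrite lastI lQ rev_rcons.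
    by rewrite SB hd [e _ x]es exj last_rev [e (head _ _) _]es /= eyz !orbT.
  + by rewrite /l AE; case: (P) nP.
  + by rewrite !last_cat.
(* [z] lies after [y]: the segment from [y] to the predecessor of [z] is reversed. *)
- have [P1 [BE PE]] : exists P1, B = P1 ++ z :: Q /\ P = rcons A x ++ y :: P1.
    have {}zB : z \in B by move: zB; rewrite inE (negbTE zy).
    case/splitPr BE: _ / zB => [B1 B2].
    have nzA : z \notin rcons A x ++ y :: B1.
      move: Ul; rewrite /l BE -cat_cons catA cat_uniq => /and3P[_ /hasPn /(_ z)].
      by rewrite mem_head => /(_ isT).
    have /(cat_cons_inj nzA nzP)[<- <-] :
        (rcons A x ++ y :: B1) ++ z :: B2 = P ++ z :: Q by rewrite -lE /l BE -catA.
    by exists B1.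
  exists (rcons A x ++ rev (y :: P1) ++ z :: Q); split.
  + by rewrite /l BE -cat_cons perm_cat2l perm_cat2r perm_rev.
  + move: SB; rewrite BE -cat_cons !(sorted_catE x) (sorted_rev_sym _ es) => /and3P[-> -> _].
    have lP : last x P = last y P1 by rewrite PE last_cat.
    have hd : head x (rev (y :: P1) ++ z :: Q) = last x P.
      by rewrite lP lastI rev_rcons.
    by rewrite SA hd last_rcons exj last_rev /= eyz !orbT.
  + by rewrite /l; case: (A).
  + by rewrite /l BE !last_cat /= !last_cat.
Qed.

(** Bondy-Chvatal step with fixed ends. Rotation handles paths on which [x] precedes [y]; the other
    order is reduced to it by reversing the whole path before and after. *)
Lemma ham_path_add_edge e X S u v x y :
  bipartite e X -> u \in X -> v \in X -> x \in X :&: S -> y \in S :\: X ->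
  ~~ e x y -> #|S :\: X| + 2 <= deg_in e S x + deg_in e S y ->
  ham_path (add_edge e x y) S u v -> ham_path e S u v.
Proof.
move=> eB uX vX /setIP[xX xS] /setDP[yS yX] nxy degxy [s [Us Ps ls Ss]].
have xl : x \in u :: s by move: xS; rewrite -Ss inE.
have yl : y \in u :: s by move: yS; rewrite -Ss inE.
have [es eX] := eB; have [fs _] := bipartite_add_edge eB xX yX.
have xy : x != y by apply: contraNneq yX => <-.
suff [l' [pl sl hl tl]] : exists l', [/\ perm_eq l' (u :: s), sorted e l',
    head x l' = u & last x l' = v].
  case: l' pl sl hl tl => [|a l'] pl sl hl tl; first by move/perm_size: pl.
  move: hl sl tl pl => /= -> sl tl pl; exists l'; split=> //.
    by rewrite (perm_uniq pl).
  by rewrite -Ss; apply/setP => z; rewrite !inE; have := perm_mem pl z; rewrite !inE.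
have Sl : sorted (add_edge e x y) (u :: s) by [].
have hu : head x (u :: s) = u by [].
have lv : last x (u :: s) = v by [].
move: (u :: s) Us Sl hu lv Ss xl yl => l Ul Sl hu lv Ss xl yl.
have [A B lE] : exists2 A, True & exists B, l = A ++ x :: B.
- by case/splitPr: xl => A B; exists A => //; exists B.
case: lE => {}B lE; subst l.
move: yl; rewrite mem_cat inE [y == x]eq_sym (negbTE xy) /= => /orP[yA|yB]; last first.
  have := @rotate_path e X x y A B eB xX yX nxy; rewrite /= cat_rcons Ss hu lv.
  by apply.
have RE : rev (A ++ x :: B) = rcons (rev B) x ++ rev A.
  by rewrite rev_cat rev_cons.
have RS : [set z in rev (A ++ x :: B)] = S.
  by rewrite -Ss; apply/setP => z; rewrite !inE mem_rev.
have := @rotate_path e X x y (rev B) (rev A) eB xX yX nxy.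
rewrite -RE /= rev_uniq mem_rev RS sorted_rev_sym //.
case=> // l' [pl sl hl tl]; exists (rev l'); split.
- by rewrite perm_rev (perm_trans pl) // perm_rev.
- by rewrite sorted_rev_sym.
- by move: tl; rewrite -(revK l') !last_rev revK hu.
- by rewrite last_rev hl -last_rev revK.
Qed.

(** * Hamiltonian paths when all pairs are joined *)

Fixpoint interleave (l1 l2 : seq T) : seq T :=
  match l1, l2 with
  | a :: l1', b :: l2' => a :: b :: interleave l1' l2'
  | _, _ => [::]
  end.

Lemma perm_interleave l1 l2 :
  size l1 = size l2 -> perm_eq (interleave l1 l2) (l1 ++ l2).
Proof.
elim: l1 l2 => [|a l1 IH] [|b l2] //= [] /IH pl.
by rewrite perm_cons -[b :: l2]cat1s perm_sym perm_catCA /= perm_cons perm_sym.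
Qed.

Lemma path_interleave e x l1 l2 :
  size l1 = size l2 ->
  (forall a b, a \in x :: l2 -> b \in l1 -> e a b && e b a) ->
  path e x (interleave l1 l2) /\ last x (interleave l1 l2) = last x l2.
Proof.
elim: l1 l2 x => [|b l1 IH] [|a l2] x //= [] sz E.
have [|pl ->] := IH l2 a sz.
  by move=> c d cl dl; apply: E; rewrite inE ?cl ?dl orbT.
rewrite pl; split=> //; have := E x b; rewrite !inE !eqxx => /(_ isT isT) /andP[-> _].
by have := E a b; rewrite !inE !eqxx orbT => /(_ isT isT) /andP[_ ->].
Qed.

Lemma ham_path_complete e X S u v :
  bipartite e X -> u \in X :&: S -> v \in X :&: S -> u != v ->
  #|X :&: S| = #|S :\: X|.+1 ->
  (forall x y, x \in X :&: S -> y \in S :\: X -> e x y) -> ham_path e S u v.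
Proof.
move=> [es eX] uS vS uv cS E.
pose l2 := rcons (enum (X :&: S :\ u :\ v)) v; pose l1 := enum (S :\: X).
have sz : size l1 = size l2.
  rewrite size_rcons -!cardE; have := cardsD1 u (X :&: S).
  have := cardsD1 v (X :&: S :\ u); rewrite uS in_setD1 vS eq_sym uv /=; lia.
have m2 z : (z \in u :: l2) = (z \in X :&: S).
  rewrite inE mem_rcons inE mem_enum !in_setD1.
  by have [->|_] := eqVneq z u; rewrite ?uS //=; have [->|_] := eqVneq z v.
have pI := perm_interleave sz.
have [|pl ll] := @path_interleave e u l1 l2 sz.
  by move=> a b; rewrite m2 mem_enum => aS bS; rewrite [e b a]es E.
exists (interleave l1 l2); split=> //; last 2 first.
- by rewrite ll /l2 last_rcons.
- apply/setP => z; rewrite !inE (perm_mem pI) mem_cat orbCA -in_cons m2 mem_enum !inE.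
  by case: (z \in X); case: (z \in S).
have -> : uniq (u :: interleave l1 l2) = uniq (l1 ++ u :: l2).
  apply: perm_uniq; rewrite perm_sym -cat1s perm_catCA /= perm_cons perm_sym //.
rewrite cat_uniq enum_uniq; apply/and3P; split=> //.
  by apply/hasPn => z; rewrite m2 mem_enum !inE => /andP[->].
rewrite /= mem_rcons inE (negbTE uv) /= rcons_uniq enum_uniq !mem_enum.
by rewrite !in_setD1 !eqxx /= !andbF.
Qed.

(** * Degree closure and vertices of low degree *)

Lemma deg_in_sub e e' S z : subrel e e' -> deg_in e S z <= deg_in e' S z.
Proof.
move=> ee'; apply: subset_leq_card; apply/subsetP => a; rewrite !inE.
by move=> /andP[-> /ee' ->].
Qed.

(** Induction on the number of nonadjacent pairs. A nonadjacent pair with degree sum at least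
    [#|S :\: X| + 2] can be joined; degrees only grow, so a low-degree set found afterwards is also
    one for the original graph. Once no such pair is left, the graph is complete bipartite on [S],
    or a vertex with a nonneighbour yields the set. *)
Lemma sparse_of_not_ham e X S u v (d : nat) :
  bipartite e X -> u \in X :&: S -> v \in X :&: S -> u != v ->
  #|X :&: S| = #|S :\: X|.+1 ->
  (forall z, z \in S -> d <= deg_in e S z) -> ~ ham_path e S u v ->
  exists b, [/\ d <= b, b + d <= #|X :&: S|
    & 0 < #|[set z in S :\: X | deg_in e S z <= b]| /\
      b <= #|[set z in S :\: X | deg_in e S z <= b]|.+1].
Proof.
move=> eB uS vS uv cS.
pose nonedges e := [set q : T * T | [&& q.1 \in X :&: S, q.2 \in S :\: X & ~~ e q.1 q.2]].
have [k] := ubnP #|nonedges e|; elim: k e eB => // k IH e eB lek mindeg nham.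
have [es eX] := eB.
have [/existsP[q /andP[]]|/existsPn nadd] := boolP [exists q, (q \in nonedges e) &&
    (#|S :\: X| + 2 <= deg_in e S q.1 + deg_in e S q.2)].
- rewrite inE => /and3P[xS yS nxy] degxy; case: q xS yS nxy degxy => x y /= xS yS nxy degxy.
  have xX : x \in X by case/setIP: xS.
  have yX : y \notin X by case/setDP: yS.
  have sub := @sub_add_edge e x y.
  have [||||b [db bd [c1 c2]]] := IH (add_edge e x y).
  + exact: bipartite_add_edge.
  + apply: leq_trans (proper_card _) lek; apply/properP; split.
      by apply/subsetP => q; rewrite !inE => /and3P[-> -> /=]; apply/contra/sub.
    exists (x, y); first by rewrite inE xS yS nxy.
    by rewrite inE /add_edge !eqxx orbT !andbF.
  + by move=> z zS; apply: leq_trans (mindeg z zS) (deg_in_sub _ _ sub).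
  + move=> h; apply: nham; have [uX _] := setIP uS; have [vX _] := setIP vS.
    exact: ham_path_add_edge eB uX vX xS yS nxy degxy h.
  + exists b; split=> //.
    have le : #|[set z in S :\: X | deg_in (add_edge e x y) S z <= b]|
       <= #|[set z in S :\: X | deg_in e S z <= b]|.
      apply: subset_leq_card; apply/subsetP => z; rewrite !(inE) => /andP[-> /=].
      exact: leq_trans (deg_in_sub _ _ sub).
    by split; [exact: leq_trans le | apply: leq_trans c2 _; rewrite ltnS].
- have [E|[[x y]]] := set_0Vmem (nonedges e).
    case: nham; apply: (ham_path_complete eB) => // x y xS yS.
    apply: contraT => nxy.
    have : (x, y) \in nonedges e by rewrite inE xS yS nxy.
    by rewrite E inE.
  rewrite inE /= => /and3P[xS yS nxy].
  have Py : [pred z | (z \in S :\: X) && ~~ e x z] y by rewrite /= yS.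
  (* The witness [b] is the largest degree among nonneighbours of [x]. Saturation gives deg x + b <=
     [#|S :\: X| + 1]; hence [b + d <= #|X :&: S|], and [x] has at least [b - 1] nonneighbours, all
     of degree at most [b]. *)
  case: (arg_maxnP (deg_in e S) Py) => z /andP[zS nxz] zmax.
  have := nadd (x, z); rewrite inE /= xS zS nxz /= -ltnNge addn2 ltnS => degxz.
  have [xX xS'] := setIP xS; have [zS' zX] := setDP zS.
  have dx := mindeg x xS'; have dz := mindeg z zS'.
  exists (deg_in e S z); split=> //.
    by rewrite cS addnC; apply: leq_trans degxz; rewrite leq_add2r.
  have cx : #|(S :\: X) :\: [set a in S | e x a]| + deg_in e S x = #|S :\: X|.
    rewrite -(cardsID [set a in S | e x a] (S :\: X)) addnC; congr (_ + _).
    congr (#|pred_of_set _|); apply/setP => a; rewrite !inE.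
    case exa: (e x a); rewrite ?andbF //.
    by move: (eX _ _ exa); rewrite xX; case: (a \in X) => // _; rewrite andbA andbb.
  have le : #|(S :\: X) :\: [set a in S | e x a]| <=
      #|[set a in S :\: X | deg_in e S a <= deg_in e S z]|.
    apply: subset_leq_card; apply/subsetP => a; rewrite !inE.
    move=> /andP[n /andP[aX aS]]; move: n; rewrite aX aS /= => n.
    by apply: zmax; rewrite /= !inE aX aS.
  split; first by apply/card_gt0P; exists z; rewrite inE zS /=.
  apply: leq_trans (_ : _ <= #|(S :\: X) :\: [set a in S | e x a]|.+1) _; last by [].
  by rewrite -(leq_add2l (deg_in e S x)) addnS (addnC (deg_in e S x) #|_|) cx.
Qed.

End HamiltonPaths.

Local Open Scope ring_scope.

(** * Spectral bound for sparse bipartite graphs *)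

Section Spectral.
Variable R : realType.
Variable T : finType.
Implicit Types (e : rel T) (X L P : {set T}).

(** Absolute values are taken in the eigenvector equation and the triangle inequality is applied.
    The eigenvector is a row vector, so the symmetry of [e] is used to sum over the neighbours of
    [z]. *)
Lemma eigenvalue_subharmonic e (r : R) :
  (forall x y, e x y = e y x) -> 0 <= r -> eigenvalue (adjmx R e) r ->
  exists w : T -> R, [/\ forall z, 0 <= w z, exists z, w z != 0
    & forall z, r * w z <= \sum_(y | e z y) w y].
Proof.
move=> es r0 /eigenvalueP[v vA v0].
exists (fun z => `|v 0 (enum_rank z)|); split=> [z||z]; first exact: normr_ge0.
  have [i vi] : exists i, v 0 i != 0.
    apply/existsP; apply: contraNT v0; rewrite negb_exists => /forallP v0.
    by apply/eqP/rowP => i; rewrite mxE; apply/eqP; rewrite -[_ == _]negbK v0.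
  by exists (enum_val i); rewrite enum_valK normr_eq0.
rewrite -{1}(ger0_norm r0) -normrM.
move/rowP: vA => /(_ (enum_rank z)); rewrite !mxE => <-.
apply: le_trans (ler_norm_sum _ _ _) _.
rewrite (reindex (@enum_rank T)) /=; last first.
  by exists enum_val => i _; rewrite ?enum_rankK ?enum_valK.
rewrite [leRHS]big_mkcond /=; apply: ler_sum => i _.
rewrite mxE !enum_rankK normrM normr_nat es.
by case: (e z i); rewrite ?mulr1 ?mulr0.
Qed.

Lemma exists_extension (A B : {set T}) (c : nat) :
  A \subset B -> (#|A| <= c <= #|B|)%N ->
  exists C : {set T}, [/\ A \subset C, C \subset B & #|C| = c].
Proof.
move=> AB /andP[Ac cB].
have [k ck] : exists k, c = (#|A| + k)%N by exists (c - #|A|)%N; lia.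
elim: k c Ac cB ck => [|k IH] c Ac cB ck; first by exists A; rewrite ck addn0.
have [||//|C [AC CB cC]] := IH (#|A| + k)%N; [lia|lia|].
have /properP[_ [z zB zC]] : C \proper B by rewrite properEcard CB cC; lia.
exists (z |: C); split.
- exact: subset_trans AC (subsetUr _ _).
- by rewrite subUset sub1set zB.
- by rewrite cardsU1 zC cC; lia.
Qed.

(** A maximiser among the [c]-subsets also dominates smaller sets: these extend to size [c], and [w]
    is nonnegative. *)
Lemma exists_top_set (X : {set T}) (w : T -> R) (c : nat) :
  (forall z, 0 <= w z) -> (c <= #|X|)%N ->
  exists P : {set T}, [/\ P \subset X, #|P| = c
    & forall A : {set T}, A \subset X -> (#|A| <= c)%N ->
      \sum_(z in A) w z <= \sum_(z in P) w z].
Proof.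
move=> w0 cX.
have [|P0 [_ P0X cP0]] := @exists_extension set0 X c (sub0set _).
  by rewrite cards0 cX.
have PP0 : [pred P : {set T} | (P \subset X) && (#|P| == c)] P0.
  by rewrite /= P0X cP0 eqxx.
case: (arg_maxP (fun P : {set T} => \sum_(z in P) w z) PP0) => P /andP[PX /eqP cP] Pmax.
exists P; split=> // A AX cA.
have [|C [AC CX cC]] := @exists_extension A X c AX; first by rewrite cA cX.
apply: le_trans (Pmax C _); last by rewrite /= CX cC eqxx.
rewrite [leRHS](big_setID A) /= (setIidPr AC) lerDl; exact: sumr_ge0.
Qed.

Lemma sum_eq_pointwise (I : finType) (A : {set I}) (F G : I -> R) :
  (forall i, i \in A -> F i <= G i) ->
  \sum_(i in A) G i <= \sum_(i in A) F i -> forall i, i \in A -> F i = G i.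
Proof.
move=> FG GF i iA; apply/eqP; rewrite eq_le FG //=.
move: GF; rewrite !(bigD1 i iA) /= => GF.
have : \sum_(j in A | j != i) F j <= \sum_(j in A | j != i) G j.
  by apply: ler_sum => j /andP[jA _]; exact: FG.
by move: GF; lra.
Qed.

(* Characteristic polynomial of the 2x2 quotient matrix of (B^T B), with B the
   biadjacency matrix of M_{n,h+t}^{n-c,t}: its roots are the squares of the
   nonzero eigenvalues of that graph. *)
Definition char2 (n h t c : nat) (l : R) :=
  (l - (n * h)%:R) * (l - (c * t)%:R) - (t * c * c * h)%:R.

(** Let [Sg] and [sg] be the sums of [w] over [X] and over a heaviest [c]-subset [P]. Then r w(y) is
    at most [sg] on [L] and at most [Sg] on the rest of Y. Summing r^2 w(x) over [P] and over [X]
    gives (r^2 - ct) sg <= ch Sg and (r^2 - nh) Sg <= ct sg, and eliminating [sg] gives q Sg <= 0.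
    If also q >= 0, every estimate is an equality, so the neighbourhoods are [P] on [L] and [X]
    elsewhere in Y. *)
Lemma sparse_spectral_bound e X L (w : T -> R) (r : R) (c : nat) :
  bipartite e X -> 0 < r ->
  (forall z, 0 <= w z) -> (exists z, w z != 0) ->
  (forall z, r * w z <= \sum_(y | e z y) w y) ->
  L \subset ~: X -> (0 < #|L|)%N -> (0 < c <= #|X|)%N ->
  (forall y, y \in L -> #|[set z | e y z]| <= c)%N ->
  (c * #|L|)%:R < r ^+ 2 ->
  let q := char2 #|X| #|~: X :\: L| #|L| c (r ^+ 2) in
  q <= 0 /\ (0 <= q -> exists P : {set T}, [/\ P \subset X, #|P| = c &
    forall x y, x \in X -> y \notin X -> e x y = (y \notin L) || (x \in P)]).
Proof.
move=> [es eX] r0 w0 [z0 wz0] sub LX tpos /andP[c0 cX] degL lct.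
have [P [PX cP Pmax]] := exists_top_set w0 cX.
set n := #|X|; set h := #|~: X :\: L|; set t := #|L|.
pose sg := \sum_(z in P) w z; pose Sg := \sum_(z in X) w z.
pose U y := if y \in L then sg else Sg.
pose D y : R := if y \in L then c%:R else n%:R.
pose dg y : R := #|[set z | e y z]|%:R.
have nbX y z : y \notin X -> e y z -> z \in X.
  by move=> yX /eX; rewrite (negbTE yX); case: (z \in X).
have nbsub y : y \notin X -> [set z | e y z] \subset X.
  by move=> yX; apply/subsetP => z; rewrite inE; exact: nbX.
have yU y : y \notin X -> r * w y <= U y.
  move=> yX; apply: le_trans (sub y) _.
  rewrite (eq_bigl (fun z => z \in [set z | e y z])); last by move=> z; rewrite inE.
  rewrite /U; case: ifP => yL; first by apply: Pmax; [exact: nbsub|exact: degL].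
  rewrite /Sg [leRHS](big_setID [set z | e y z]) /= (setIidPr (nbsub y yX)) lerDl.
  exact: sumr_ge0.
(* If [w] vanished on [X], subharmonicity would make it vanish on Y as well. *)
have Sg0 : 0 < Sg.
  rewrite lt_def sumr_ge0 // andbT; apply: contraNneq wz0 => S0.
  have wX z : z \in X -> w z = 0.
    by move=> zX; apply/eqP; have := psumr_eq0P (fun i _ => w0 i) S0 zX => ->.
  have [/wX -> //|z0X] := boolP (z0 \in X).
  have := sub z0; rewrite big1 => [|y /(nbX _ _ z0X)]; last exact: wX.
  by rewrite pmulr_rle0 // => wle; rewrite eq_le wle w0.
have sg0 : 0 < sg.
  rewrite lt_def sumr_ge0 // andbT; apply: contraTneq Sg0 => s0.
  rewrite -leNgt; apply: sumr_le0 => z zX.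
  have := Pmax [set z]; rewrite sub1set cards1 big_set1 => /(_ zX c0).
  by rewrite -/sg s0.
have U0 y : 0 < U y by rewrite /U; case: ifP.
have rowx x : x \in X -> r ^+ 2 * w x <= \sum_(y in ~: X) (e x y)%:R * (r * w y).
  move=> xX; rewrite expr2 -mulrA.
  apply: le_trans (ler_wpM2l (ltW r0) (sub x)) _.
  rewrite mulr_sumr big_mkcond [leRHS]big_mkcond /=; apply: ler_sum => y _.
  have [exy|_] := boolP (e x y); last by case: ifP => // _; rewrite mul0r.
  have -> : y \in ~: X by rewrite inE; have := eX _ _ exy; rewrite xX; case: (y \in X).
  by rewrite mul1r.
have sumU : \sum_(y in ~: X) U y = h%:R * Sg + t%:R * sg.
  rewrite (big_setID L) /= (setIidPr LX) addrC; congr (_ + _).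
    rewrite (eq_bigr (fun=> Sg)) ?sumr_const ?mulr_natl //.
    by move=> y; rewrite !inE /U => /andP[/negbTE ->].
  rewrite (eq_bigr (fun=> sg)) ?sumr_const ?mulr_natl //.
  by move=> y; rewrite /U => ->.
have sumDU : \sum_(y in ~: X) D y * U y = (n * h)%:R * Sg + (c * t)%:R * sg.
  rewrite (big_setID L) /= (setIidPr LX) addrC; congr (_ + _).
    rewrite (eq_bigr (fun=> n%:R * Sg)) ?sumr_const.
      by rewrite -mulr_natl natrM -/h; ring.
    by move=> y; rewrite !inE /U /D => /andP[/negbTE ->].
  rewrite (eq_bigr (fun=> c%:R * sg)) ?sumr_const.
    by rewrite -mulr_natl natrM -/t; ring.
  by move=> y; rewrite /U /D => ->.
have entry x y : y \in ~: X -> (e x y)%:R * (r * w y) <= U y.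
  rewrite inE => yX; case: (e x y); rewrite ?mul1r ?mul0r; first exact: yU.
  exact: ltW.
have colD y : y \in ~: X -> \sum_(x in X) (e x y)%:R * (r * w y) = dg y * (r * w y).
  rewrite inE => yX; rewrite -mulr_suml /dg; congr (_ * _).
  rewrite -sum1_card natr_sum [LHS]big_mkcond [RHS]big_mkcond /=.
  apply: eq_bigr => x _; rewrite inE es.
  by case: (boolP (e y x)) => [/(nbX _ _ yX) ->|_]; case: (x \in X).
have dgD y : y \in ~: X -> dg y <= D y.
  rewrite inE /D /dg => yX; case: ifP => yL; rewrite ler_nat; first exact: degL.
  exact: subset_leq_card (nbsub y yX).
have D0 y : 0 < D y.
  by rewrite /D; case: ifP => _; rewrite ltr0n //; apply: leq_trans c0 _.
have dgDU y : y \in ~: X -> dg y * (r * w y) <= D y * U y.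
  move=> yX; apply: ler_pM (dgD y yX) _ => //; first by rewrite mulr_ge0 // ltW.
  by apply: yU; rewrite inE in yX.
have h1 : r ^+ 2 * sg <= \sum_(x in P) \sum_(y in ~: X) (e x y)%:R * (r * w y).
  by rewrite mulr_sumr; apply: ler_sum => x xP; exact: rowx (subsetP PX _ xP).
have h1' : \sum_(x in P) \sum_(y in ~: X) (e x y)%:R * (r * w y)
    <= \sum_(x in P) \sum_(y in ~: X) U y.
  by apply: ler_sum => x _; apply: ler_sum => y; exact: entry.
have E1 : \sum_(x in P) \sum_(y in ~: X) U y = c%:R * (h%:R * Sg + t%:R * sg).
  by rewrite sumr_const cP sumU [RHS]mulr_natl.
have h2 : r ^+ 2 * Sg <= \sum_(y in ~: X) dg y * (r * w y).
  rewrite mulr_sumr -(eq_bigr _ colD) exchange_big /=.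
  by apply: ler_sum => x xP; apply/rowx.
have h2' : \sum_(y in ~: X) dg y * (r * w y) <= \sum_(y in ~: X) D y * U y.
  exact: ler_sum.
pose a := r ^+ 2 - (n * h)%:R; pose b := r ^+ 2 - (c * t)%:R.
have b0 : 0 < b by rewrite subr_gt0.
have i1 : b * sg <= c%:R * h%:R * Sg.
  have := le_trans h1 h1'; rewrite E1 /b natrM; lra.
have i2 : a * Sg <= (c * t)%:R * sg.
  have := le_trans h2 h2'; rewrite sumDU /a; lra.
have ct0 : 0 < (c * t)%:R :> R by rewrite ltr0n muln_gt0 c0.
(* Multiplying by [b], positive by the assumption on [c * #|L|], allows [sg] to be eliminated with
   [i1]. *)
have i2b : a * Sg * b <= (c * t)%:R * sg * b by rewrite ler_pM2r.
have i1c : (c * t)%:R * (b * sg) <= (c * t)%:R * (c%:R * h%:R * Sg) by rewrite ler_pM2l.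
have qE : char2 n h t c (r ^+ 2) = a * b - (c * t)%:R * (c%:R * h%:R).
  by rewrite /char2 -/a -/b !natrM; ring.
rewrite /= qE; split.
  by rewrite -(pmulr_lle0 _ Sg0); lra.
move=> q0.
(* The elimination run backwards: [i1] and [i2] are equalities, hence so are all the bounds summed
   to obtain them. *)
have qS : 0 <= (a * b - (c * t)%:R * (c%:R * h%:R)) * Sg by rewrite mulr_ge0 // ltW.
have j1 : c%:R * h%:R * Sg <= b * sg by rewrite -(ler_pM2l ct0); lra.
have j2 : (c * t)%:R * sg <= a * Sg by rewrite -(ler_pM2r b0); lra.
have eq1 : forall x, x \in P -> \sum_(y in ~: X) (e x y)%:R * (r * w y) = \sum_(y in ~: X) U y.
  apply: sum_eq_pointwise => [x _|]; first by apply: ler_sum => y; exact: entry.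
  by apply: le_trans h1; rewrite E1; move: j1; rewrite /b natrM; lra.
have eq2 : forall y, y \in ~: X -> dg y * (r * w y) = D y * U y.
  apply: sum_eq_pointwise => //.
  by apply: le_trans h2; rewrite sumDU; move: j2; rewrite /a; lra.
have PY x y : x \in P -> y \notin X -> e x y.
  move=> xP yX; have yX' : y \in ~: X by rewrite inE.
  have := sum_eq_pointwise (entry x) _ yX'; rewrite eq1 // => /(_ (lexx _)).
  by case: (e x y) => //; rewrite mul0r => U00; have := U0 y; rewrite -U00 ltxx.
(* A degree below [D y] would make the bound at [y] strict, because [U y] is positive. *)
have dgE y : y \notin X -> dg y = D y.
  move=> yX; have yX' : y \in ~: X by rewrite inE.
  apply/eqP; rewrite eq_le dgD //= leNgt; apply/negP => lt.
  have := eq2 y yX'; apply/eqP; rewrite lt_eqF //.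
  apply: le_lt_trans (_ : dg y * U y < _); last by rewrite ltr_pM2r.
  by apply: ler_wpM2l; [exact: ler0n | exact: yU].
exists P; split=> // x y xX yX.
have cd : #|[set z | e y z]| = if y \in L then c else n.
  by have /eqP := dgE y yX; rewrite /dg /D; case: ifP => _; rewrite eqr_nat => /eqP.
have [yL|yL] /= := boolP (y \in L).
  have PE : P = [set z | e y z].
    apply/eqP; rewrite eqEcard cd yL cP leqnn andbT.
    by apply/subsetP => z zP; rewrite inE es PY.
  by rewrite PE inE es.
have XE : [set z | e y z] = X.
  by apply/eqP; rewrite eqEcard nbsub // cd (negbTE yL) leqnn.
by have := xX; rewrite -XE inE es.
Qed.

End Spectral.

(** * The graphs M *)

(** Listing [A] before [B] turns membership in [B] into a threshold on positions, the form in which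
    [Mrel] describes its classes. *)
Lemma index_enum_cat (T : finType) (A B : {set T}) (z : T) :
  z \in A :|: B -> [disjoint A & B] ->
  (index z (enum A ++ enum B) < #|A| + #|B|)%N /\
  (#|A| <= index z (enum A ++ enum B))%N = (z \in B).
Proof.
move=> zAB dAB; split.
  by rewrite !cardE -size_cat index_mem mem_cat !mem_enum -in_setU.
rewrite index_cat mem_enum; case: ifP => zA.
  have -> : (z \in B) = false by apply: (disjointFr dAB).
  by apply/negbTE; rewrite -ltnNge cardE index_mem mem_enum.
move: zAB; rewrite inE zA /= => ->.
by rewrite cardE leq_addr.
Qed.

(** [P] and [L] play the roles of X_2 and Y_2, so each is listed last within its part. *)
Lemma graph_iso_Mrel (T : finType) (e : rel T) (X L P : {set T})
    (n m s t : nat) :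
  bipartite e X -> #|X| = n -> #|~: X| = m -> (0 < n)%N -> (0 < m)%N ->
  (s <= n)%N -> P \subset X -> #|P| = (n - s)%N ->
  L \subset ~: X -> #|L| = t ->
  (forall x y, x \in X -> y \notin X -> e x y = (y \notin L) || (x \in P)) ->
  graph_iso e (Mrel n m s t).
Proof.
move=> [es eX] cX cY n0 m0 sn PX cP LY cL E.
case: n cX n0 sn cP => // n cX _ sn cP; case: m cY m0 => // m cY _.
have cXP : #|X :\: P| = s by have := cardsID P X; rewrite (setIidPr PX); lia.
have cYL : #|~: X :\: L| = (m.+1 - t)%N.
  by have := cardsID L (~: X); rewrite (setIidPr LY); lia.
have disj (A B : {set T}) : [disjoint A :\: B & B].
  by rewrite -setI_eq0; apply/eqP/setP => z; rewrite !inE; case: (z \in B); rewrite ?andbF.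
pose lX := enum (X :\: P) ++ enum P; pose lY := enum (~: X :\: L) ++ enum L.
have XP z : z \in X -> z \in (X :\: P) :|: P by rewrite !inE => ->; case: (z \in P).
have YL z : z \notin X -> z \in (~: X :\: L) :|: L by rewrite !inE => ->; case: (z \in L).
have iX z : z \in X -> (index z lX < n.+1)%N /\ (s <= index z lX)%N = (z \in P).
  by move=> /XP zX; have [] := index_enum_cat zX (disj _ _); rewrite cXP cP subnKC.
have tm : (t <= m.+1)%N by rewrite -cL -cY subset_leq_card.
have iY z : z \notin X ->
    (index z lY < m.+1)%N /\ (m.+1 - t <= index z lY)%N = (z \in L).
  by move=> /YL zY; have [] := index_enum_cat zY (disj _ _); rewrite cYL cL subnK.
pose f z : 'I_n.+1 + 'I_m.+1 :=
  if z \in X then inl (inord (index z lX)) else inr (inord (index z lY)).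
have fI : injective f.
  move=> a b; rewrite /f; case: ifP => aX; case: ifP => bX // [] /(congr1 val) /=.
    have [ia _] := iX a aX; have [ib _] := iX b bX.
    rewrite !inordK // => ab.
    have al : a \in lX by rewrite mem_cat !mem_enum -in_setU XP.
    have bl : b \in lX by rewrite mem_cat !mem_enum -in_setU XP.
    by rewrite -(nth_index a al) ab nth_index.
  move/negbT in aX; move/negbT in bX.
  have [ia _] := iY a aX; have [ib _] := iY b bX.
  rewrite !inordK // => ab.
  have al : a \in lY by rewrite mem_cat !mem_enum -in_setU YL.
  have bl : b \in lY by rewrite mem_cat !mem_enum -in_setU YL.
  by rewrite -(nth_index a al) ab nth_index.
exists f; split.
  apply: inj_card_bij fI _; rewrite card_sum !card_ord -cX -cY.
  by rewrite -(cardsC X).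
have XY a b : a \in X -> b \notin X -> Mrel n.+1 m.+1 s t (f a) (f b) = e a b.
  move=> aX bX; rewrite /f aX (negbTE bX) /= E //.
  have [ia iaP] := iX a aX; have [ib ibP] := iY b bX.
  by rewrite !inordK // iaP ltnNge ibP.
move=> a b; have [aX|aX] := boolP (a \in X); have [bX|bX] := boolP (b \in X).
- rewrite /f aX bX /=; apply/esym/negP => /eX; rewrite aX bX //.
- exact: XY.
- rewrite es -XY //.
  by rewrite /f bX (negbTE aX).
- rewrite /f (negbTE aX) (negbTE bX) /=; apply/esym/negP => /eX.
  by rewrite (negbTE aX) (negbTE bX).
Qed.

Section MSpectrum.
Variable R : realType.

Lemma sum_threshold (n s : nat) (a b : R) :
  (s <= n)%N ->
  \sum_(i < n) (if (i < s)%N then a else b) = s%:R * a + (n - s)%:R * b.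
Proof.
move=> sn; rewrite -(big_mkord xpredT (fun i => if (i < s)%N then a else b)).
rewrite (@big_cat_nat _ _ _ s) //=; congr (_ + _).
  rewrite big_nat_cond (eq_bigr (fun=> a)) => [|i /andP[/andP[_ ->]]] //.
  by rewrite -big_nat_cond sumr_const_nat subn0 mulr_natl.
rewrite big_nat_cond (eq_bigr (fun=> b)) => [|i /andP[/andP[si _] _]].
  by rewrite -big_nat_cond sumr_const_nat mulr_natl.
by rewrite ltnNge si.
Qed.

(** The eigenvector is constant on X_1, X_2, Y_1 and Y_2. The equations on Y_1 and X allow y1 : y2 =
    ct : g with g = mu - nh, and then determine x1 and x2; the remaining equation, on Y_2, is the
    vanishing of [char2]. *)
Lemma Mrel_eigenvalue (n m s t : nat) (mu : R) :
  (s < n)%N -> (0 < t < m)%N -> 0 < mu ->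
  char2 n (m - t) t (n - s) mu = 0 ->
  eigenvalue (adjmx R (Mrel n m s t)) (Num.sqrt mu).
Proof.
move=> sn /andP[t0 tm] mu0 qmu.
set rho := Num.sqrt mu; have rho2 : rho * rho = mu by rewrite -expr2 sqr_sqrtr // ltW.
have rho0 : 0 < rho by rewrite sqrtr_gt0.
pose h := (m - t)%N; pose c := (n - s)%N.
pose g : R := mu - (n * h)%:R.
pose x1 : R := h%:R * (c%:R * t%:R); pose x2 : R := x1 + t%:R * g.
pose y1 : R := rho * (c%:R * t%:R); pose y2 : R := rho * g.
have c0 : 0 < c%:R :> R by rewrite ltr0n subn_gt0.
have t0' : 0 < t%:R :> R by rewrite ltr0n.
have nE : n%:R = s%:R + c%:R :> R by rewrite -natrD subnKC // ltnW.
have mh : (m - h = t)%N by rewrite /h; lia.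
have hm : (h <= m)%N by rewrite leq_subr.
have qmu' : g * (mu - c%:R * t%:R) = t%:R * c%:R * c%:R * h%:R.
  by move/eqP: qmu; rewrite /char2 subr_eq0 => /eqP; rewrite -/h -/c -/g !natrM.
pose F (z : 'I_n + 'I_m) : R := match z with
  | inl i => if (i < s)%N then x1 else x2
  | inr j => if (j < h)%N then y1 else y2 end.
have FE z : \sum_w F w * (Mrel n m s t w z)%:R = rho * F z.
  rewrite big_sumType /=; case: z => [i|j] /=.
    rewrite [X in X + _]big1 ?add0r => [|k _]; last by rewrite mulr0.
    have [is_|si] := ltnP i s.
      rewrite (eq_bigr (fun k : 'I_m => if (k < h)%N then y1 else 0)).
        by rewrite sum_threshold // mulr0 addr0 /y1 /x1; ring.
      by move=> k _; rewrite orbF -/h; case: ifP; rewrite ?mulr1 ?mulr0.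
    rewrite (eq_bigr (fun k : 'I_m => if (k < h)%N then y1 else y2)).
      by rewrite sum_threshold // mh /y1 /y2 /x2 /x1; ring.
    by move=> k _; rewrite orbT mulr1.
  rewrite [X in _ + X]big1 ?addr0 => [|k _]; last by rewrite mulr0.
  rewrite -/h; have [jh|hj] /= := ltnP j h.
    rewrite (eq_bigr (fun k : 'I_n => if (k < s)%N then x1 else x2)).
      rewrite sum_threshold 1?ltnW // -/c /y1 mulrA rho2 /x2 /x1.
      have -> : mu = g + (s%:R + c%:R) * h%:R by rewrite /g natrM nE; ring.
      by ring.
    by move=> k _; rewrite mulr1.
  rewrite (eq_bigr (fun k : 'I_n => if (k < s)%N then 0 else x2)).
    rewrite sum_threshold 1?ltnW // -/c /y2 mulrA rho2 /x2 /x1 mulr0 add0r.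
    by move: qmu'; lra.
  by move=> k _; rewrite ltnNge; case: (s <= k)%N; rewrite ?mulr1 ?mulr0.
apply/eigenvalueP; exists (\row_i F (enum_val i)).
  apply/rowP => i; rewrite !mxE -FE.
  rewrite (reindex (@enum_rank ('I_n + 'I_m)%type)) /=; last first.
    by exists enum_val => k _; rewrite ?enum_rankK ?enum_valK.
  by apply: eq_bigr => k _; rewrite !mxE enum_rankK.
have hpos : (0 < h)%N by rewrite subn_gt0.
have m0 : (0 < m)%N by apply: leq_trans hm.
apply/negP => /eqP/rowP/(_ (enum_rank (inr (Ordinal m0)))).
rewrite !mxE enum_rankK /= hpos => /eqP.
by rewrite gt_eqF // !mulr_gt0.
Qed.

(** Let [mu] be the larger root of [char2]. Its square root is an eigenvalue, hence at most [r]. As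
    the product term [k] is positive, [mu] exceeds both [a] and [b], and beyond [mu] the quadratic
    is nonnegative. *)
Lemma Mrel_radius_bounds (n m s t : nat) (r r' : R) :
  (s < n)%N -> (0 < t < m)%N -> is_spectral_radius (Mrel n m s t) r -> r <= r' ->
  [/\ 0 < r', ((n - s) * t)%:R < r' ^+ 2, (n * (m - t))%:R < r' ^+ 2
    & 0 <= char2 n (m - t) t (n - s) (r' ^+ 2)].
Proof.
move=> sn tm [_ rmax] rr'; have /andP[t0 tm'] := tm.
set h := (m - t)%N; set c := (n - s)%N.
pose a : R := (n * h)%:R; pose b : R := (c * t)%:R; pose k : R := (t * c * c * h)%:R.
have a0 : 0 < a by rewrite ltr0n muln_gt0 subn_gt0 tm' andbT (leq_ltn_trans _ sn).
have b0 : 0 < b by rewrite ltr0n muln_gt0 subn_gt0 sn.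
have k0 : 0 < k by rewrite ltr0n !muln_gt0 t0 /c /h !subn_gt0 sn tm'.
pose sD := Num.sqrt ((a - b) ^+ 2 + 4 * k).
have D0 : 0 <= (a - b) ^+ 2 + 4 * k by rewrite addr_ge0 ?sqr_ge0 // mulr_ge0 // ltW.
have sD2 : sD ^+ 2 = (a - b) ^+ 2 + 4 * k by rewrite sqr_sqrtr.
have sD0 : 0 <= sD by rewrite sqrtr_ge0.
have sDab : `|a - b| < sD.
  by rewrite -(ltr_pXn2r (n := 2)) ?nnegrE // sD2 real_normK ?num_real // ltrDl mulr_gt0.
pose mu := (a + b + sD) / 2.
have mua : a < mu by move: sDab; rewrite ltr_norml => /andP[]; rewrite /mu; lra.
have mub : b < mu by move: sDab; rewrite ltr_norml => /andP[]; rewrite /mu; lra.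
have mu0 : 0 < mu by apply: lt_trans mua.
have q0 : char2 n h t c mu = 0.
  by rewrite /char2 -/a -/b -/k /mu; move: sD2; rewrite !expr2; lra.
have rho_le : Num.sqrt mu <= r by apply/rmax/Mrel_eigenvalue.
have rho0 : 0 < Num.sqrt mu by rewrite sqrtr_gt0.
have r'0 : 0 < r' by apply: lt_le_trans (le_trans rho_le rr').
have mur : mu <= r' ^+ 2.
  rewrite -(sqr_sqrtr (ltW mu0)) ler_pXn2r ?nnegrE ?(ltW rho0) ?(ltW r'0) //.
  exact: le_trans rr'.
split=> //; [exact: lt_le_trans mur | exact: lt_le_trans mur |].
rewrite /char2 -/a -/b -/k; move: (r' ^+ 2) mur => l lmu.
have E : (l - a) * (l - b) - k = (l - mu) * (l - (a + b - sD) / 2).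
  by rewrite /mu; move: sD2; rewrite !expr2; lra.
by rewrite E mulr_ge0 ?subr_ge0 //; apply: le_trans lmu; rewrite /mu; lra.
Qed.

(** With n = N + p, [q b] is the quadratic of M_{n,n-1}^{N-b,b-1}. The factorisation exposes the
    coefficient N + 1 - b - d, whose sign separates the two comparisons below. *)
Lemma char2_diff (N p b d l : R) :
  let q b := (l - (N + p) * (N + p - b)) * (l - (b + p) * (b - 1))
     - (b - 1) * (b + p) * (b + p) * (N + p - b) in
  q b - q d = (b - d) *
    ((N + 1 - b - d) * (l + (N + p - 1) * (p + 1) + (b - 1) * (N - b - 1)
       + (d - 1) * (N - d)) - (d - 1) * (N - d)).
Proof. move=> q; rewrite /q; ring. Qed.

Lemma char2_natE (N p b : nat) (l : R) :
  (0 < b <= N)%N -> char2 (N + p) (N + p - b) (b - 1) (b + p) l =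
  (l - (N%:R + p%:R) * (N%:R + p%:R - b%:R)) * (l - (b%:R + p%:R) * (b%:R - 1))
     - (b%:R - 1) * (b%:R + p%:R) * (b%:R + p%:R) * (N%:R + p%:R - b%:R).
Proof.
move=> /andP[b0 bN]; have bNp : (b <= N + p)%N := leq_trans bN (leq_addr _ _).
by rewrite /char2 !natrM (natrB _ b0) (natrB _ bNp) !natrD.
Qed.

(** Here N + 1 - b - d >= 1, so the summand (d - 1)(N - d) inside the factor pays for the subtracted
    one, and [l > 0] makes the factor positive. *)
Lemma char2_lt_small (N p b d : nat) (l : R) :
  0 < l -> (0 < d < b)%N -> (b + d <= N)%N ->
  char2 (N + p) (N + p - d) (d - 1) (d + p) l <
  char2 (N + p) (N + p - b) (b - 1) (b + p) l.
Proof.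
move=> l0 /andP[d0 db] bdN; rewrite !char2_natE; [|lia|lia].
rewrite -subr_gt0 (char2_diff N%:R p%:R b%:R d%:R).
have p0 : 0 <= p%:R :> R by [].
have d1 : 1 <= d%:R :> R by rewrite ler1n.
have db1 : d%:R + 1 <= b%:R :> R by rewrite natr1 ler_nat.
have bdN' : b%:R + d%:R <= N%:R :> R by rewrite -natrD ler_nat.
have G : 0 <= (d%:R - 1) * (N%:R - d%:R) :> R by rewrite mulr_ge0; lra.
have K1 : 0 <= (N%:R + p%:R - 1) * (p%:R + 1) :> R by rewrite mulr_ge0; lra.
have K2 : 0 <= (b%:R - 1) * (N%:R - b%:R - 1) :> R by rewrite mulr_ge0; lra.
apply: mulr_gt0; first by lra.
set K := _ + (b%:R - 1) * _; have K0 : 0 < K by rewrite /K; lra.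
set F := (_ - d%:R); have F1 : 1 <= F by rewrite /F; lra.
move: G; set G := (d%:R - 1) * _ => G0; nra.
Qed.

(** At d = N - 1 the coefficient is 2 - b <= 0 and the subtracted term is N - 2 > 0, so the second
    factor and b - d are both negative. *)
Lemma char2_lt_large (N p b : nat) (l : R) :
  0 < l -> (2 <= b)%N -> (b.+1 < N)%N ->
  char2 (N + p) (N + p - N.-1) (N.-1 - 1) (N.-1 + p) l <
  char2 (N + p) (N + p - b) (b - 1) (b + p) l.
Proof.
move=> l0 b2 bN; rewrite !char2_natE; [|lia|lia].
rewrite -subr_gt0 (char2_diff N%:R p%:R b%:R N.-1%:R).
have p0 : 0 <= p%:R :> R by [].
have b2' : 2 <= b%:R :> R by rewrite ler_nat.
have -> : N.-1%:R = N%:R - 1 :> R by rewrite -subn1 natrB //; lia.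
have bN' : b%:R + 2 <= N%:R :> R by rewrite -natrD ler_nat; lia.
have K1 : 0 <= (N%:R + p%:R - 1) * (p%:R + 1) :> R by rewrite mulr_ge0; lra.
have K2 : 0 <= (b%:R - 1) * (N%:R - b%:R - 1) :> R by rewrite mulr_ge0; lra.
set K := _ + (b%:R - 1) * _; have K0 : 0 < K by rewrite /K; lra.
rewrite nmulr_rgt0; last by lra.
have -> : (N%:R + 1 - b%:R - (N%:R - 1)) = 2 - b%:R :> R by ring.
have -> : (N%:R - 1 - 1) * (N%:R - (N%:R - 1)) = N%:R - 2 :> R by ring.
have F : (2 - b%:R) * (K + (N%:R - 2)) <= 0 by rewrite mulr_le0_ge0 //; lra.
by lra.
Qed.

End MSpectrum.

(** * Extremality *)

(** Since [W] has [p] vertices in each part, removing it lowers each degree by at most [p]. The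
    minimum degree left is at least [k - p], and degree at most [b] after the removal means at most
    [b + p] in the whole graph. *)
Lemma low_degree_set_of_not_ham (T : finType) (e : rel T) (X W : {set T})
    (p k n : nat) (u v : T) :
  bipartite e X -> #|X| = n -> #|~: X| = n.-1 -> min_degree_ge e k ->
  (p < k)%N -> (p + 3 <= n)%N ->
  #|W :&: X| = p -> #|W :\: X| = p ->
  u \in X :&: ~: W -> v \in X :&: ~: W -> u != v ->
  ~ ham_path e (~: W) u v ->
  exists (b : nat) (L : {set T}),
    [/\ (2 <= b)%N, (k - p <= b)%N, (b + (k - p) <= n - p)%N &
    [/\ L \subset ~: X, #|L| = (b - 1)%N
      & forall y, y \in L -> (#|[set z | e y z]| <= b + p)%N]].
Proof.
move=> eB cX cY md pk pn WX WY uS vS uv nham; have [es eX] := eB.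
have cXS : #|X :&: ~: W| = (n - p)%N.
  by rewrite -setDE cardsD cX setIC WX.
have cSY : #|~: W :\: X| = (n.-1 - p)%N.
  by rewrite setDE setIC -setDE cardsD cY [~: X :&: W]setIC -setDE WY.
have nb x : [set y | e x y] \subset if x \in X then ~: X else X.
  apply/subsetP => y; rewrite inE => /eX.
  by case: (x \in X); rewrite ?inE; case: (y \in X).
have dW x : (#|[set y | e x y]| <= deg_in e (~: W) x + p)%N.
  have -> : deg_in e (~: W) x = #|[set y | e x y] :\: W|.
    by congr #|pred_of_set _|; apply/setP => y; rewrite !inE.
  rewrite -(cardsID W) addnC leq_add2l.
  have := nb x; have [xX|xX] := boolP (x \in X) => nbx; [rewrite -WY|rewrite -WX];
    apply: subset_leq_card.
    by rewrite setIC setDE; apply: setIS.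
  by rewrite setIC; apply: setIS.
have [||b0 [db bd [c1 c2]]] := @sparse_of_not_ham T e X (~: W) u v (k - p) eB uS vS uv _ _ nham.
- by rewrite cXS cSY; lia.
- by move=> z _; have := dW z; have := md z; lia.
rewrite cXS in bd.
(* Rounding up makes [L] nonempty. It matters only if [b0 = k - p = 1]; then [p + 3 <= n] keeps the
   upper bound on [b], and [c1] supplies the one vertex required. *)
pose b := maxn b0 2.
have sub : [set z in ~: W :\: X | deg_in e (~: W) z <= b0]%N \subset
   [set z in ~: W :\: X | deg_in e (~: W) z <= b]%N.
  apply/subsetP => z; rewrite !inE => /andP[-> /=]; rewrite /b; lia.
have cb := subset_leq_card sub.
have [|L [_ LS cL]] := @exists_extension T set0
   [set z in ~: W :\: X | deg_in e (~: W) z <= b]%N (b - 1) (sub0set _).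
  by rewrite cards0 /=; move: cb c1 c2; rewrite /b; lia.
exists b, L; split; [rewrite /b; lia|rewrite /b; lia|rewrite /b; lia|split=> //].
- apply/subsetP => z /(subsetP LS); rewrite !inE => /andP[/andP[]] //.
- move=> y /(subsetP LS); rewrite !inE => /andP[_ dy].
  by apply: leq_trans (dW y) _; rewrite leq_add2r.
Qed.

(** The sparse bound gives q_b(r'^2) <= 0, while the comparison with M gives q_{b0}(r'^2) >= 0. The
    strict order of the quadratics forces [b = b0], and the equality case identifies the graph. The
    final disjunction yields (b + p)(b - 1) < r'^2 from one of the two lower bounds on r'^2. *)
Lemma iso_of_extremal (R : realType) (T : finType) (e : rel T) (X L : {set T})
    (p n b0 b : nat) (r r' : R) :
  bipartite e X -> #|X| = n -> #|~: X| = n.-1 ->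
  (2 <= b0)%N -> (b0 + p < n)%N -> (2 <= b)%N -> (b + p < n)%N ->
  is_spectral_radius (Mrel n (n - 1) (n - p - b0) (b0 - 1)) r ->
  is_spectral_radius e r' -> r <= r' ->
  L \subset ~: X -> #|L| = (b - 1)%N ->
  (forall y, y \in L -> (#|[set z | e y z]| <= b + p)%N) ->
  (b != b0 -> forall l : R, 0 < l ->
     char2 n (n - b0) (b0 - 1) (b0 + p) l < char2 n (n - b) (b - 1) (b + p) l) ->
  ((b + p) * (b - 1) <= (b0 + p) * (b0 - 1))%N \/
  ((b + p) * (b - 1) <= n * (n - b0))%N ->
  graph_iso e (Mrel n (n - 1) (n - p - b0) (b0 - 1)).
Proof.
move=> eB cX cY b02 b0n b2 bn Mr [er' _] rr' LX cL degL qlt small.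
have [||r'0 l1 l2 q0] := Mrel_radius_bounds _ _ Mr rr'; [lia|lia|].
have E1 : (n - (n - p - b0) = b0 + p)%N by lia.
have E2 : (n - 1 - (b0 - 1) = n - b0)%N by lia.
rewrite E1 in l1 q0; rewrite E2 in l2 q0.
have cYL : #|~: X :\: L| = (n - b)%N.
  by have := cardsID L (~: X); rewrite (setIidPr LX) cL cY; lia.
have [es _] := eB.
have [w [w0 wn0 wsub]] := eigenvalue_subharmonic es (ltW r'0) er'.
have [||||q1 iso] := @sparse_spectral_bound R T e X L w r' (b + p) eB r'0 w0 wn0 wsub LX.
- by rewrite cL; lia.
- by rewrite cX; lia.
- exact: degL.
- rewrite cL; case: small => small.
    by apply: le_lt_trans l1; rewrite ler_nat.
  by apply: le_lt_trans l2; rewrite ler_nat.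
rewrite cX cYL cL in q1 iso.
have l0 : 0 < r' ^+ 2 by rewrite exprn_gt0.
have [bb0|bb0] := eqVneq b b0; last first.
  by have := lt_le_trans (le_lt_trans q0 (qlt bb0 _ l0)) q1; rewrite ltxx.
subst b0; have [P [PX cP E]] := iso q0.
have [n0 m0 sn] : [/\ 0 < n, 0 < n - 1 & n - p - b <= n]%N.
  by clear -b2 bn; split; lia.
by apply: (@graph_iso_Mrel T e X L P) => //; rewrite ?E1 ?subn1.
Qed.

Theorem theorem1p7 (R : realType) (p k n : nat) (T : finType) (e : rel T)
    (X : {set T}) :
  bipartite e X -> nearly_balanced X -> #|T| = (2 * n - 1)%N ->
  min_degree_ge e k ->
  ((k = p.+1 ->
    (2 * k + 3 <= n)%N ->
    rho_le R (Mrel n (n - 1)%N 1%N (n - k - 1)%N) e ->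
    ~ graph_iso e (Mrel n (n - 1)%N 1%N (n - k - 1)%N) ->
    ham_biconnected_2p e X p)
  /\
   ((p + 2 <= k)%N ->
    ((k + 2) * (k - p + 1) <= 2 * n)%N ->
    rho_le R (Mrel n (n - 1)%N (n - k)%N (k - p - 1)%N) e ->
    ~ graph_iso e (Mrel n (n - 1)%N (n - k)%N (k - p - 1)%N) ->
    ham_biconnected_2p e X p)).
Proof.
move=> eB nb cT md.
have [cX cY] : #|X| = n /\ #|~: X| = n.-1.
  by have := cardsC X; rewrite nb cT; have := nb; rewrite /nearly_balanced; lia.
have balW (W : {set T}) : #|W :&: X| = #|W :\: X| -> #|W| = (2 * p)%N ->
    #|W :&: X| = p /\ #|W :\: X| = p.
  by move=> bW cW; have := cardsID X W; lia.
split.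
- move=> kE nk [r [r' [Mr er' rr']]] niso W bW cW u v uS vS uv.
  have [WX WY] := balW W bW cW.
  apply: contrapT => nham; apply: niso.
  have [||b [L [b2 kb bk [LX cL degL]]]] :=
    low_degree_set_of_not_ham eB cX cY md _ _ WX WY uS vS uv nham; [lia|lia|].
  (* The extremal parameter is b0 = N - 1 with N = n - p; as [k = p.+1], b0 - 1 is [n - k - 1]. *)
  have E1 : (n - p - (n - p).-1 = 1)%N by lia.
  have E2 : ((n - p).-1 - 1 = n - k - 1)%N by lia.
  have nE : (n - p + p = n)%N by lia.
  have ME : Mrel n (n - 1) 1 (n - k - 1)
      = Mrel n (n - 1) (n - p - (n - p).-1) ((n - p).-1 - 1) by rewrite E1 E2.
  rewrite ME in Mr *.
  apply: (iso_of_extremal eB cX cY _ _ b2 _ Mr er' rr' LX cL degL); [lia|lia|lia| |].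
    move=> bb l l0; have := @char2_lt_large R (n - p) p b l l0.
    by rewrite nE; apply; lia.
  by left; apply: leq_mul; lia.
- move=> pk nk [r [r' [Mr er' rr']]] niso W bW cW u v uS vS uv.
  have [WX WY] := balW W bW cW.
  apply: contrapT => nham; apply: niso.
  (* The factors [k + 2] and [k - p + 1] are at least [p + 4] and 3. *)
  have n3 : (p + 3 <= n)%N by have : (3 * (p + 4) <= 2 * n)%N; [|lia];
    apply: leq_trans nk; rewrite mulnC; apply: leq_mul; lia.
  have pk' : (p < k)%N by lia.
  have [b [L [b2 kb bk [LX cL degL]]]] :=
    low_degree_set_of_not_ham eB cX cY md pk' n3 WX WY uS vS uv nham.
  (* Here b0 is the smallest admissible value [k - p]. *)
  have E1 : (n - p - (k - p) = n - k)%N by lia.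
  have nE : (n - p + p = n)%N by lia.
  rewrite -E1 in Mr *.
  apply: (iso_of_extremal eB cX cY _ _ b2 _ Mr er' rr' LX cL degL); [lia|lia|lia| |].
    move=> bb l l0; have := @char2_lt_small R (n - p) p b (k - p) l l0.
    by rewrite nE; apply; lia.
  by right; apply: leq_mul; lia.
Qed.
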